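(* Let $A$ be an $n\times n$ rank two, positive semidefinite matrix, and let $B$ be an $n\times n$ rank one, positive semidefinite matrix such that both $A$ and $B$ have all their entries positive. Suppose $A\ge B$, and $A-B$ has rank one. Let $k$ be the Hadamard power rank of $A$, and let $r$ be a nonnegative real number. If $A-B$ has all diagonal entries nonzero, then $A^{\circ r}\ge B^{\circ r}$ if and only if either $r>k-1$ or $r\in\{0,1,\ldots,k-1\}$. If $A-B$ has a zero diagonal entry, then $A^{\circ r}\ge B^{\circ r}$ if and only if either $r>k-2$ or $r\in\{0,1,\ldots,k-2\}$.
   Context: For Hermitian matrices $M,N$, $M\ge N$ means that $M-N$ is positive semidefinite. For a matrix $A=[a_{ij}]$ with positive entries, $A^{\circ r}=[a_{ij}^r]$ is its $r$th Hadamard (entrywise) power. The Hadamard power rank of a nonzero matrix $A$ is the largest integer $k$ for which there is a list of $k$ distinct columns of $A$ such that no column in the list is a scalar multiple of any other column in the list. *)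

(* Defs.v *)
From HB Require Import structures.
From mathcomp Require Import all_boot all_order all_algebra.
From mathcomp Require Import all_classical all_reals all_analysis.

Set Implicit Arguments.
Unset Strict Implicit.
Unset Printing Implicit Defensive.

Import Order.TTheory GRing.Theory Num.Theory.
Local Open Scope ring_scope.

(* Matrices with positive entries are real, so Hermitian matrices appear here
   as real symmetric ones. *)
Definition psdmx (R : realType) (n : nat) (M : 'M[R]_n) : Prop :=
  M^T = M /\ forall x : 'cV[R]_n, 0 <= (x^T *m M *m x) 0 0.

Definition loewner_ge (R : realType) (n : nat) (M N : 'M[R]_n) : Prop :=
  psdmx (M - N).

(* Meant for matrices with positive entries: there [powR] is the usual real
   power. *)
Definition hadamard_pow (R : realType) (n : nat) (r : R) (A : 'M[R]_n) :
    'M[R]_n :=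
  map_mx (fun a => a `^ r) A.

(* A list of distinct columns of [A] is encoded by the set of their indices. *)
Definition pairwise_nonmultiple (R : realType) (n : nat) (A : 'M[R]_n)
    (S : {set 'I_n}) : Prop :=
  forall i j : 'I_n, i \in S -> j \in S -> i != j ->
    ~ exists c : R, col i A = c *: col j A.

Definition hadamard_power_rank (R : realType) (n : nat) (A : 'M[R]_n) : nat :=
  \max_(S : {set 'I_n} | `[< pairwise_nonmultiple A S >]) #|S|.

(* Main.v *)
Require Import Defs.
From HB Require Import structures.
From mathcomp Require Import all_boot all_order all_algebra.
From mathcomp Require Import all_classical all_reals all_analysis.
From mathcomp Require Import ring lra zify.

Set Implicit Arguments.
Unset Strict Implicit.
Unset Printing Implicit Defensive.

Import Order.TTheory GRing.Theory Num.Theory.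
Import numFieldNormedType.Exports.
Local Open Scope ring_scope.

(* Write [B = b b^T] and [A - B = c c^T], and put [x_i = c_i / b_i].  Up to a
   positive diagonal congruence, [A^{o r} - B^{o r}] is the matrix
   [(1 + x_i x_j)^r - 1], which is the Schur complement, with respect to an added
   point [x_0 = 0], of [(1 + x_i x_j)^r].  The Hadamard power rank of [A] is the
   number of distinct values of [x], so everything reduces to: on [N] distinct
   points, [(1 + x_i x_j)^r] is positive semidefinite iff [r >= N - 2] or [r] is a
   natural number.

   Sufficiency is an induction on [N]: a Schur complement followed by a Moebius
   change of points turns the matrix for [N] points into [(1 + z_i z_j)^r - 1] for
   [N - 1] points, and the latter is the integral over [t] in [0, 1] of matrices of
   the same kind with exponent [r - 1].

   For necessity, take [m < r < m + 1] and the [m + 3] smallest points.  By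
   dimension there is a nonzero [c] such that
   [f(t) = sum_j c_j (1 + x_j t)^r] vanishes at all points but the last one, so
   that the quadratic form at [c] is [c_N f(x_N)] with [N = m + 2].  A Rolle
   argument that tracks signs shows that [f(x_N)] has the sign of
   [c_N r (r - 1) ... (r - m - 1)], hence that of [- c_N]. *)

(** * Zeros of sums of powers of affine functions *)

Lemma MVT_closed (R : realType) (f df : R -> R) (a b : R) : a < b ->
  (forall t, a <= t <= b -> is_derive t 1 f (df t)) ->
  exists2 c, a < c < b & f b - f a = df c * (b - a).
Proof.
move=> ab fd; have fc : {within `[a, b], continuous f}%classic.
  apply: derivable_within_continuous => t; rewrite in_itv /= => /fd dft.
  exact: ex_derive.
have fd' t : t \in `]a, b[ -> is_derive t 1 f (df t).
  by rewrite in_itv /= => /andP[at_ tb]; apply: fd; rewrite !ltW.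
have [c] := MVT ab fd' fc.
by rewrite in_itv /= => cab E; exists c.
Qed.

Lemma is_derive_big (R : realType) (I : eqType) (l : seq I) (F : I -> R -> R)
    (dF : I -> R) (t : R) :
  (forall i, i \in l -> is_derive t 1 (F i) (dF i)) ->
  is_derive t 1 (fun u => \sum_(i <- l) F i u) (\sum_(i <- l) dF i).
Proof.
elim: l => [_|i l IH dFt].
  rewrite big_nil; under eq_fun do rewrite big_nil.
  exact: is_derive_cst.
rewrite big_cons; under eq_fun do rewrite big_cons.
apply: is_deriveD; first by apply: dFt; rewrite mem_head.
by apply: IH => j jl; apply: dFt; rewrite inE jl orbT.
Qed.

Lemma is_derive_powR_affine (R : realType) (a s t : R) : 0 < 1 + a * t ->
  is_derive t 1 (fun u => (1 + a * u) `^ s) (s * (1 + a * t) `^ (s - 1) * a).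
Proof.
move=> at_gt0.
have da : is_derive t 1 (fun u : R => 1 + a * u) a.
  by apply: is_derive_eq; rewrite add0r mul1r /GRing.scale /= mulr1.
exact: (@is_derive1_comp R (@powR R ^~ s) (fun u => 1 + a * u) t _ _
  (is_derive1_powR s at_gt0) da).
Qed.

Lemma powR_pred (R : realType) (u s : R) : 0 < u -> u `^ s = u `^ (s - 1) * u.
Proof.
move=> u_gt0; rewrite -{3}(powRr1 (ltW u_gt0)) -powRD ?subrK //.
by rewrite (gt_eqF u_gt0) implybT.
Qed.

Lemma affine_gt0 (R : realType) (x a b w : R) :
  0 < 1 + x * a -> 0 < 1 + x * b -> a < w < b -> 0 < 1 + x * w.
Proof. by move=> xa xb /andP[aw wb]; have [x0|x0] := lerP 0 x; nra. Qed.

(* Dividing by [(1 + x_0 t)^s] and differentiating kills the [0]th term and lowers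
   the exponent of the others; the mean value theorem on the last interval carries
   the sign of the value at [z N] over to the derivative. *)
Lemma sgr_last_value (R : realType) (N : nat) (s : R) (x c z : nat -> R) :
  (forall i, (i < N)%N -> x i < x N) -> (forall i, (i < N)%N -> z i < z i.+1) ->
  (forall i j, (i <= N)%N -> (j <= N)%N -> 0 < 1 + x i * z j) ->
  (forall i, (i < N)%N -> \sum_(j < N.+1) c j * (1 + x j * z i) `^ s = 0) ->
  Num.sg (\sum_(j < N.+1) c j * (1 + x j * z N) `^ s) =
  Num.sg (c N * \prod_(i < N) (s - i%:R)).
Proof.
elim: N s x c z => [|N IH] s x c z xN zS xz f0.
  by rewrite big_ord1 big_ord0 mulr1 sgrM (gtr0_sg (powR_gt0 _ _)) ?mulr1 ?xz.
pose w t := 1 + x 0%N * t.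
pose F t := w t `^ (- s) * \sum_(j < N.+2) c j * (1 + x j * t) `^ s.
pose c' j := s * (x j.+1 - x 0%N) * c j.+1.
pose G t := \sum_(j < N.+1) c' j * (1 + x j.+1 * t) `^ (s - 1).
have dF t : (forall i, (i <= N.+1)%N -> 0 < 1 + x i * t) ->
    is_derive t 1 F (w t `^ (- s - 1) * G t).
  move=> xt.
  pose H (j : 'I_N.+2) (u : R) :=
    c j * ((1 + x 0%N * u) `^ (- s) * (1 + x j * u) `^ s).
  pose dH (j : 'I_N.+2) := c j * (w t `^ (- s - 1) *
     (s * (1 + x j * t) `^ (s - 1) * (x j - x 0%N))).
  have -> : F = (fun u => \sum_j H j u).
    by apply/funext => u; rewrite /F mulr_sumr; apply: eq_bigr => j _;
      rewrite /H /w mulrCA.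
  have -> : w t `^ (- s - 1) * G t = \sum_j dH j.
    rewrite [RHS]big_ord_recl /dH subrr !mulr0 add0r mulr_sumr.
    by apply: eq_bigr => j _; rewrite /c' /=; ring.
  apply: is_derive_big => j _; have xj := xt j (ltn_ord j).
  have d0 := is_derive_powR_affine (- s) (xt 0%N isT).
  have d1 := is_derive_powR_affine s xj.
  apply: (is_derive_eq (is_deriveZ (c j) (is_deriveM d0 d1))).
  rewrite /dH /GRing.scale /= -/(w t).
  (* Once both powers are lowered by one, the numerator [x j * (1 + x 0 * t) - x 0 * (1 + x j * t)]
     collapses to [x j - x 0]. *)
  rewrite (powR_pred s xj) (@powR_pred _ (w t) (- s)) /w ?xt //.
  by ring.
have zlt i : (i < N.+1)%N -> exists t, z i < t < z i.+1 /\
    F (z i.+1) - F (z i) = w t `^ (- s - 1) * G t * (z i.+1 - z i).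
  move=> iN; have [|t zt E] := @MVT_closed _ F
    (fun t => w t `^ (- s - 1) * G t) _ _ (zS i iN).
    move=> t /andP[zt tz]; apply: dF => j jN.
    have [->|] := eqVneq t (z i); first by rewrite xz // ltnW.
    have [->|] := eqVneq t (z i.+1); first by rewrite xz.
    move=> t1 t2; apply: (@affine_gt0 _ _ (z i) (z i.+1)); rewrite ?xz // 1?ltnW //.
    by rewrite !lt_neqAle t1 zt tz eq_sym t2.
  by exists t.
(* [choice] needs a total function of [i]; for [i > N] the value [0] is a dummy. *)
have /choice[y yP] (i : nat) : exists t, (i < N.+1)%N -> z i < t < z i.+1 /\
    F (z i.+1) - F (z i) = w t `^ (- s - 1) * G t * (z i.+1 - z i).
  by have [/zlt[t tP]|] := ltnP i N.+1; [exists t | exists 0].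
have xy i j : (i < N.+2)%N -> (j < N.+1)%N -> 0 < 1 + x i * y j.
  move=> iN jN; have [yj _] := yP j jN.
  by apply: affine_gt0 yj; rewrite xz // ltnW.
have F0 i : (i < N.+1)%N -> F (z i) = 0 by move=> /f0; rewrite /F => ->; rewrite mulr0.
have := IH (s - 1) (fun j => x j.+1) c' y; rewrite -!/(G _) => IHG.
have {}IHG : Num.sg (G (y N)) = Num.sg (c' N * \prod_(i < N) (s - 1 - i%:R)).
  apply: IHG.
  - by move=> i iN; rewrite xN.
  - move=> i iN; have [/andP[_ yi] _] := yP i (ltnW iN).
    by have [/andP[+ _] _] := yP i.+1 iN; apply: lt_trans.
  - by move=> i j iN jN; apply: xy.
  - move=> i iN; have [_] := yP i (ltnW iN).
    rewrite (F0 i.+1 iN) (F0 i (ltnW iN)) subrr => /esym/eqP.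
    rewrite !mulf_eq0 gt_eqF ?powR_gt0 ?(xy 0%N i isT (ltnW iN)) //=.
    by rewrite subr_eq0 (gt_eqF (zS i (ltnW iN))) orbF => /eqP.
have sF : Num.sg (F (z N.+1)) = Num.sg (G (y N)).
  have [_] := yP N (ltnSn N); rewrite (F0 N) // subr0 => ->.
  rewrite !sgrM (gtr0_sg (powR_gt0 _ _)) ?xy // mul1r.
  by rewrite (gtr0_sg (_ : 0 < z N.+1 - z N)) ?mulr1 // subr_gt0 zS.
have -> : Num.sg (\sum_(j < N.+2) c j * (1 + x j * z N.+1) `^ s) =
    Num.sg (F (z N.+1)).
  by rewrite /F sgrM (gtr0_sg (powR_gt0 _ _)) ?mul1r // xz.
(* The factor [s] of [c'] is the factor [i = 0] of the product; the others are those for [s - 1],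
   shifted by one. *)
rewrite sF IHG big_ord_recl subr0 /c' !sgrM.
rewrite (gtr0_sg (_ : 0 < x N.+1 - x 0%N)) ?subr_gt0 ?xN // mulr1.
have -> : \prod_(i < N) (s - (lift ord0 i)%:R) = \prod_(i < N) (s - 1 - i%:R).
  by apply: eq_bigr => i _; rewrite lift0 -natr1; ring.
by ring.
Qed.

(** The falling product of a non-natural [s] is nonzero, so vanishing at the last point too forces
    the last coefficient to be 0; induction removes the others. *)
Lemma powR_sum_eq0 (R : realType) (N : nat) (s : R) (x c : nat -> R) :
  (forall i : nat, s != i%:R) ->
  (forall i j, (i < j)%N -> (j < N)%N -> x i < x j) ->
  (forall i j, (i < N)%N -> (j < N)%N -> 0 < 1 + x i * x j) ->
  (forall i, (i < N)%N -> \sum_(j < N) c j * (1 + x j * x i) `^ s = 0) ->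
  forall i, (i < N)%N -> c i = 0.
Proof.
move=> s_nat; elim: N => [//|N IH] xS xx f0.
have cN : c N = 0.
  have := @sgr_last_value R N s x c x (fun i iN => xS i N iN (ltnSn N))
    (fun i iN => xS i i.+1 (ltnSn i) iN) xx (fun i iN => f0 i (ltnW iN)).
  rewrite f0 // sgr0 => /esym/eqP; rewrite sgr_eq0 mulf_eq0 => /orP[/eqP //|].
  by rewrite prodf_seq_eq0 => /hasP[i _]; rewrite subr_eq0 (negPf (s_nat i)).
have {}IH : forall i, (i < N)%N -> c i = 0.
  apply: IH => [i j ij jN|i j iN jN|i iN].
  - by apply: xS => //; apply: ltnW.
  - by apply: xx; apply: ltnW.
  - by have := f0 i (ltnW iN); rewrite big_ord_recr /= cN mul0r addr0.
by move=> i; rewrite ltnS leq_eqVlt => /orP[/eqP -> //|]; apply: IH.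
Qed.

Lemma falling_lt0 (R : realType) (m : nat) (s : R) : m%:R < s < m.+1%:R ->
  \prod_(i < m.+2) (s - i%:R) < 0.
Proof.
move=> /andP[ms sm]; rewrite big_ord_recr /= pmulr_rlt0 ?subr_lt0 //.
apply: prodr_gt0 => i _; rewrite subr_gt0 (le_lt_trans _ ms) //.
by rewrite ler_nat -ltnS.
Qed.

Lemma powR_form_lt0 (R : realType) (m : nat) (s : R) (x : nat -> R) :
  m%:R < s < m.+1%:R ->
  (forall i j, (i < j)%N -> (j < m.+3)%N -> x i < x j) ->
  (forall i j, (i < m.+3)%N -> (j < m.+3)%N -> 0 < 1 + x i * x j) ->
  exists c : nat -> R,
    \sum_(i < m.+3) \sum_(j < m.+3) c i * c j * (1 + x i * x j) `^ s < 0.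
Proof.
move=> ms xS xx.
pose K : 'M[R]_(m.+3, m.+2) := \matrix_(j, i) (1 + x j * x i) `^ s.
(* There are [m + 3] rows for [m + 2] columns, hence a nontrivial left kernel. *)
have : kermx K != 0.
  rewrite kermx_eq0 /row_free neq_ltn ltnS.
  by rewrite (leq_trans (rank_leq_col K)).
case/rowV0Pn => v /sub_kermxP vK v0.
pose c (j : nat) := v 0 (inord j).
pose f (i : nat) := \sum_(j < m.+3) c j * (1 + x j * x i) `^ s.
have f0 i : (i < m.+2)%N -> f i = 0.
  move=> im; have := congr1 (fun u : 'rV_m.+2 => u 0 (Ordinal im)) vK.
  by rewrite !mxE => <-; apply: eq_bigr => j _; rewrite mxE /c inord_val.
exists c.
have -> : \sum_(i < m.+3) \sum_(j < m.+3) c i * c j * (1 + x i * x j) `^ s =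
    c m.+2 * f m.+2.
  transitivity (\sum_(i < m.+3) c i * f i).
    apply: eq_bigr => i _; rewrite mulr_sumr; apply: eq_bigr => j _.
    by rewrite [x i * _]mulrC mulrA.
  rewrite big_ord_recr big1 => [|i _] /=; first by rewrite add0r.
  by rewrite f0 ?mulr0.
have sf : Num.sg (f m.+2) = - Num.sg (c m.+2).
  rewrite (@sgr_last_value R m.+2 s x c x) //; last first.
  - by move=> i im; apply: xS.
  - by move=> i im; apply: xS.
  by rewrite sgrM (ltr0_sg (falling_lt0 ms)) mulrN1.
rewrite -sgr_cp0 sgrM sf mulrN -expr2 eqr_opp sqr_sg.
(* Strictness: if the last coefficient were 0, [f] would vanish at every point and [powR_sum_eq0]
   would give [v = 0]. *)
have [c0|//] := eqVneq (c m.+2) 0.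
have fN0 : f m.+2 = 0 by apply/eqP; rewrite -sgr_eq0 sf c0 sgr0 oppr0.
have s_nat (i : nat) : s != i%:R.
  apply/eqP => si; move: ms; rewrite si !ltr_nat; lia.
have c_eq0 i : (i < m.+3)%N -> c i = 0.
  apply: (@powR_sum_eq0 _ _ s x) => // j; rewrite ltnS leq_eqVlt.
  by move=> /orP[/eqP -> //|]; apply: f0.
case/negP: v0; apply/eqP/rowP => j; rewrite mxE -(c_eq0 j (ltn_ord j)) /c.
by rewrite inord_val.
Qed.

(** * Positivity of the quadratic forms *)

(** Weighted points form a list, so that they may repeat and can be mapped or dropped freely. *)
Definition qform (R : realType) (T : Type) (K : T -> T -> R)
    (l : seq (R * T)) : R :=
  \sum_(a <- l) \sum_(b <- l) a.1 * b.1 * K a.2 b.2.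

Lemma qform_map (R : realType) (T U : Type) (K : T -> T -> R)
    (f : U -> R * T) (l : seq U) :
  qform K [seq f a | a <- l] =
  \sum_(a <- l) \sum_(b <- l) (f a).1 * (f b).1 * K (f a).2 (f b).2.
Proof. by rewrite /qform big_map; apply: eq_bigr => a _; rewrite big_map. Qed.

Lemma qform_filter (R : realType) (T : Type) (K : T -> T -> R) (P : pred T)
    (l : seq (R * T)) :
  (forall x y, ~~ P x -> K x y = 0) -> (forall x y, ~~ P y -> K x y = 0) ->
  qform K [seq a <- l | P a.2] = qform K l.
Proof.
move=> K0l K0r; rewrite /qform big_filter [RHS](bigID (fun a => P a.2)) /=.
rewrite [X in _ = _ + X]big1 ?addr0 => [|a Pa]; last first.
  by rewrite big1 // => b _; rewrite K0l ?mulr0.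
apply: eq_bigr => a _; rewrite big_filter [RHS](bigID (fun b => P b.2)) /=.
by rewrite [X in _ = _ + X]big1 ?addr0 // => b Pb; rewrite K0r ?mulr0.
Qed.

Lemma qform_powR_sub1_eq0 (R : realType) (l : seq (R * R)) :
  qform (fun x y => (1 + x * y) `^ 0 - 1) l = 0.
Proof.
rewrite /qform big1 // => a _; rewrite big1 // => b _.
by rewrite powRr0 subrr mulr0.
Qed.

Lemma affine01_gt0 (R : realType) (u t : R) :
  0 < 1 + u -> 0 <= t <= 1 -> 0 < 1 + u * t.
Proof. by move=> u0 /andP[t0 t1]; have [|] := lerP 0 u; nra. Qed.

(* FitzGerald-Horn: the form is the integral over [0, 1] of its derivative in
   the parameter [t] of [(1 + t x y) `^ s]. *)
Lemma qform_powR_sub1_step (R : realType) (s : R) (l : seq (R * R)) :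
  0 <= s -> (forall a b, a \in l -> b \in l -> 0 < 1 + a.2 * b.2) ->
  (forall t : R, 0 < t < 1 -> 0 <= qform (fun x y => (1 + x * y) `^ (s - 1))
     [seq (a.1 * a.2, Num.sqrt t * a.2) | a <- l]) ->
  0 <= qform (fun x y => (1 + x * y) `^ s - 1) l.
Proof.
move=> s_ge0 ll Hl.
pose phi (t : R) :=
  \sum_(a <- l) \sum_(b <- l) a.1 * b.1 * (1 + a.2 * b.2 * t) `^ s.
pose dphi (t : R) := \sum_(a <- l) \sum_(b <- l)
  a.1 * b.1 * (s * (1 + a.2 * b.2 * t) `^ (s - 1) * (a.2 * b.2)).
have dphiP (t : R) : 0 <= t <= 1 -> is_derive t 1 phi (dphi t).
  move=> t01; apply: is_derive_big => a al; apply: is_derive_big => b bl.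
  apply: is_deriveZ; apply: is_derive_powR_affine.
  by apply: affine01_gt0 => //; apply: ll.
(* The mean value theorem stands in for the integral: the form is the derivative at one interior
   [c]. *)
have [c /andP[c0 c1] E] := @MVT_closed _ phi dphi 0 1 ltr01 dphiP.
have -> : qform (fun x y => (1 + x * y) `^ s - 1) l = phi 1 - phi 0.
  rewrite /phi -sumrB; apply: eq_bigr => a _; rewrite -sumrB.
  by apply: eq_bigr => b _; rewrite mulr1 mulr0 addr0 powR1 -mulrBr.
rewrite E subr0 mulr1.
have -> : dphi c = s * qform (fun x y => (1 + x * y) `^ (s - 1))
    [seq (a.1 * a.2, Num.sqrt c * a.2) | a <- l].
  rewrite qform_map mulr_sumr; apply: eq_bigr => a _; rewrite mulr_sumr.
  apply: eq_bigr => b _ /=.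
  have -> : Num.sqrt c * a.2 * (Num.sqrt c * b.2) = a.2 * b.2 * c.
    by rewrite -[c in RHS]sqr_sqrtr ?(ltW c0) //; ring.
  by ring.
by rewrite mulr_ge0 // Hl // c0 c1.
Qed.

(* Chosen so that the Schur complement of [(1 + x y)^s] at the point [a] becomes a
   diagonal congruence of [(1 + mobius a x * mobius a y)^s - 1]. *)
Definition mobius (R : realType) (a x : R) : R := (x - a) / (1 + a * x).

Lemma mobiusE (R : realType) (a x y : R) : 0 < 1 + a * x -> 0 < 1 + a * y ->
  1 + mobius a x * mobius a y =
  (1 + x * y) * (1 + a * a) / ((1 + a * x) * (1 + a * y)).
Proof.
move=> /gt_eqF/negbT ax /gt_eqF/negbT ay; rewrite /mobius; field.
by rewrite ax ay.
Qed.

Lemma mobius_gt0 (R : realType) (a x y : R) : 0 < 1 + a * x -> 0 < 1 + a * y -> 0 < 1 + x * y ->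
  0 < 1 + mobius a x * mobius a y.
Proof.
move=> ax ay xy; rewrite mobiusE // divr_gt0 ?mulr_gt0 //.
by rewrite ltr_pwDl // -expr2 sqr_ge0.
Qed.

(** With [K x y = (1 + x * y)^s], [mobiusE] turns [K a a * K x y] into [K a x * K a y * K x' y'] at
    the Moebius images; writing [K x' y'] as [1 + (K x' y' - 1)] isolates the square. *)
Lemma qform_schur (R : realType) (a s : R) (l : seq (R * R)) :
  (forall b, b \in l -> 0 < 1 + a * b.2) ->
  (forall b c, b \in l -> c \in l -> 0 < 1 + b.2 * c.2) ->
  (1 + a * a) `^ s * qform (fun x y => (1 + x * y) `^ s) l =
  (\sum_(b <- l) b.1 * (1 + a * b.2) `^ s) ^+ 2 +
  qform (fun x y => (1 + x * y) `^ s - 1)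
    [seq (b.1 * (1 + a * b.2) `^ s, mobius a b.2) | b <- l].
Proof.
move=> al ll; rewrite expr2 qform_map mulr_suml /= {1}/qform mulr_sumr. rewrite -[RHS]big_split /=.
rewrite big_seq [RHS]big_seq; apply: eq_bigr => b bl.
rewrite mulr_sumr [in RHS]mulr_sumr -[RHS]big_split /= big_seq [RHS]big_seq.
apply: eq_bigr => c cl.
have aa : 0 <= 1 + a * a by rewrite addr_ge0 // -expr2 sqr_ge0.
have ab := al _ bl; have ac := al _ cl; have bc := ll _ _ bl cl.
have E : (1 + a * a) `^ s * (1 + b.2 * c.2) `^ s =
    (1 + mobius a b.2 * mobius a c.2) `^ s * (1 + a * b.2) `^ s * (1 + a * c.2) `^ s.
  have bc0 := ltW (mobius_gt0 ab ac bc).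
  rewrite -(powRM s aa (ltW bc)) -(powRM s bc0 (ltW ab)).
  rewrite -(powRM s (mulr_ge0 bc0 (ltW ab)) (ltW ac)) mobiusE //.
  congr (_ `^ s); field; by rewrite !gt_eqF.
rewrite mulrCA E; ring.
Qed.

(** Each round removes the point [a] and lowers the exponent by one: [size D - s] is unchanged, and
    a natural [s] stays natural until it is 0, where the Schur complement vanishes. *)
Lemma qform_powR_ge0 (R : realType) (D : seq R) (s : R) (l : seq (R * R)) :
  (forall x y, x \in D -> y \in D -> 0 < 1 + x * y) ->
  (forall b, b \in l -> b.2 \in D) ->
  ((size D)%:R <= s + 2 \/ exists m : nat, s = m%:R) ->
  0 <= qform (fun x y => (1 + x * y) `^ s) l.
Proof.
have [n] := ubnP (size D); elim: n D s l => // n IH [|a D] s l sDn DD lD Hs.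
  by case: l lD => [_|b l /(_ b (mem_head _ _))] //; rewrite /qform big_nil.
have aD := mem_head a D.
have al b : b \in l -> 0 < 1 + a * b.2 by move=> /lD; apply: DD.
have ll b c : b \in l -> c \in l -> 0 < 1 + b.2 * c.2.
  by move=> /lD bD /lD; apply: DD.
have aa := DD a a aD aD.
rewrite -(pmulr_rge0 _ (powR_gt0 s aa)) qform_schur //.
rewrite addr_ge0 ?sqr_ge0 //.
(* Since [mobius a a = 0], dropping the zero points removes every copy of [a]. *)
rewrite -(@qform_filter _ _ _ (fun x => x != 0)) => [|x y|x y]; last 2 first.
- by rewrite negbK => /eqP ->; rewrite mul0r addr0 powR1 subrr.
- by rewrite negbK => /eqP ->; rewrite mulr0 addr0 powR1 subrr.
set l' := [seq _ <- _ | _].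
have l'P b : b \in l' -> exists2 x, x \in D & b.2 = mobius a x.
  rewrite mem_filter => /andP[b0 /mapP[c cl bE]]; exists c.2; last by rewrite bE.
  have := lD c cl; rewrite inE => /orP[/eqP ca|//].
  by move: b0; rewrite bE /= ca /mobius subrr mul0r eqxx.
have DD' x y : x \in D -> y \in D -> 0 < 1 + mobius a x * mobius a y.
  by move=> xD yD; apply: mobius_gt0; apply: DD; rewrite ?aD // inE ?xD ?yD orbT.
have ll' b c : b \in l' -> c \in l' -> 0 < 1 + b.2 * c.2.
  by move=> /l'P[x xD ->] /l'P[y yD ->]; apply: DD'.
(* With the single point [a], [s] may be negative; this case is closed before deriving [0 <= s]. *)
case D0 : D => [|d D1].
  have -> : l' = [::].
    by case: l' l'P {ll'} => // b l1 /(_ b (mem_head _ _))[x]; rewrite D0.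
  by rewrite /qform big_nil.
have s_ge0 : 0 <= s.
  case: Hs => [|[m ->] //]; rewrite D0 /= -addn2 natrD => Hs.
  have := ler0n R (size D1); lra.
have [->|s0] := eqVneq s 0; first by rewrite qform_powR_sub1_eq0.
apply: qform_powR_sub1_step => // t /andP[t0 t1].
pose z x := Num.sqrt t * mobius a x.
have zz x y : z x * z y = mobius a x * mobius a y * t.
  by rewrite /z -[t in RHS]sqr_sqrtr ?(ltW t0) //; ring.
apply: (IH [seq z x | x <- D]).
- by rewrite size_map.
- move=> _ _ /mapP[x xD ->] /mapP[y yD ->]; rewrite zz.
  by apply: affine01_gt0; rewrite ?DD' // !ltW.
- by move=> _ /mapP[b /l'P[x xD E] ->] /=; rewrite E; apply: map_f.
- case: Hs => [|[[|m] sm]].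
  + by rewrite size_map /= -natr1 => Hs; left; lra.
  + by rewrite sm eqxx in s0.
  + by right; exists m; rewrite sm -natr1 addrK.
Qed.

(** One step reduces to [qform_powR_ge0] at exponent [s - 1] with rescaled points, whence the bound
    [s + 1 = (s - 1) + 2]. *)
Lemma qform_powR_sub1_ge0 (R : realType) (D : seq R) (s : R)
    (l : seq (R * R)) :
  (forall x y, x \in D -> y \in D -> 0 < 1 + x * y) ->
  (forall b, b \in l -> b.2 \in D) -> 0 <= s ->
  ((size D)%:R <= s + 1 \/ exists m : nat, s = m%:R) ->
  0 <= qform (fun x y => (1 + x * y) `^ s - 1) l.
Proof.
move=> DD lD s_ge0 Hs.
have ll b c : b \in l -> c \in l -> 0 < 1 + b.2 * c.2.
  by move=> /lD bD /lD; apply: DD.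
have [->|s0] := eqVneq s 0; first by rewrite qform_powR_sub1_eq0.
apply: qform_powR_sub1_step => // t /andP[t0 t1].
have tt x y : Num.sqrt t * x * (Num.sqrt t * y) = x * y * t.
  by rewrite -[t in RHS]sqr_sqrtr ?(ltW t0) //; ring.
apply: (@qform_powR_ge0 _ [seq Num.sqrt t * x | x <- D]).
- move=> _ _ /mapP[x xD ->] /mapP[y yD ->]; rewrite tt.
  by apply: affine01_gt0; rewrite ?DD // !ltW.
- by move=> _ /mapP[b /lD bD ->]; apply: map_f.
- case: Hs => [|[[|m] sm]].
  + by rewrite size_map => Hs; left; lra.
  + by rewrite sm eqxx in s0.
  + by right; exists m; rewrite sm -natr1 addrK.
Qed.

(** * Loewner order between the Hadamard powers *)

Lemma psdmx_qform_ge0 (R : realType) (n : nat) (M : 'M[R]_n)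
    (l : seq (R * 'I_n)) :
  psdmx M -> 0 <= qform (fun i j => M i j) l.
Proof.
case=> _ /(_ (\sum_(a <- l) a.1 *: delta_mx a.2 0)).
congr (0 <= _).
rewrite [X in X *m M *m _]linear_sum !mulmx_suml summxE; apply: eq_bigr => a _.
rewrite mulmx_sumr summxE; apply: eq_bigr => b _.
rewrite [X in X *m M *m _]linearZ /= trmx_delta -!scalemxAl -scalemxAr -rowE -colE !mxE.
by rewrite mulrA.
Qed.

Lemma mul_form_qform (R : realType) (n : nat) (M : 'M[R]_n) (v : 'cV[R]_n) :
  (v^T *m M *m v) 0 0 =
  qform (fun i j => M i j) [seq (v i 0, i) | i <- index_enum 'I_n].
Proof.
rewrite qform_map mxE exchange_big; apply: eq_bigr => j _ /=.
rewrite mxE mulr_suml; apply: eq_bigr => i _.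
by rewrite mxE mulrAC.
Qed.

Lemma exists_preimage_seq (R T U : eqType) (f : U -> T) (l : seq (R * T)) :
  (forall a, a \in l -> exists i, f i = a.2) ->
  exists l' : seq (R * U), l = [seq (a.1, f a.2) | a <- l'].
Proof.
elim: l => [_|a l IH fl]; first by exists [::].
have [l' ->] : exists l' : seq (R * U), l = [seq (a.1, f a.2) | a <- l'].
  by apply: IH => b bl; apply: fl; rewrite inE bl orbT.
have [i fi] := fl a (mem_head _ _).
by exists ((a.1, i) :: l'); rewrite /= fi; case: a {fl fi}.
Qed.

(** For the kernel [(1 + y * z)^r], equal to 1 when a point is 0, this is the Schur complement at
    the added point 0. *)
Lemma qform_add1 (R : realType) (T : Type) (K : T -> T -> R)
    (l : seq (R * T)) :
  qform K l = (\sum_(a <- l) a.1) ^+ 2 + qform (fun x y => K x y - 1) l.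
Proof.
rewrite expr2 mulr_suml -[RHS]big_split; apply: eq_bigr => a _ /=.
rewrite mulr_sumr -[RHS]big_split; apply: eq_bigr => b _ /=; ring.
Qed.

Definition distinct_values (R : realType) (n : nat) (x : 'I_n -> R) : seq R :=
  undup [seq x i | i <- enum 'I_n].

Lemma distinct_valuesP (R : realType) (n : nat) (x : 'I_n -> R) (y : R) :
  reflect (exists i, x i = y) (y \in distinct_values x).
Proof.
rewrite mem_undup; apply: (iffP mapP) => [[i _ ->]|[i <-]]; first by exists i.
by exists i => //; rewrite mem_enum.
Qed.

Section Criterion.
Variables (R : realType) (n : nat) (b x : 'I_n -> R) (A B : 'M[R]_n) (r : R).
Hypotheses (b_gt0 : forall i, 0 < b i).
Hypothesis xx_gt0 : forall i j, 0 < 1 + x i * x j.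
Hypothesis AE : forall i j, A i j = b i * b j * (1 + x i * x j).
Hypothesis BE : forall i j, B i j = b i * b j.
Hypothesis r_ge0 : 0 <= r.

(** The value 0 is left out because the corresponding rows and columns of [M] vanish. *)
Let D := [seq y <- distinct_values x | y != 0].

Let M := hadamard_pow r A - hadamard_pow r B.

Let ME i j : M i j = b i `^ r * b j `^ r * ((1 + x i * x j) `^ r - 1).
Proof.
rewrite !mxE AE BE !powRM ?mulr_ge0 ?ltW //; ring.
Qed.

Let K0l (y z : R) : ~~ (y != 0) -> (1 + y * z) `^ r - 1 = 0.
Proof. by rewrite negbK => /eqP ->; rewrite mul0r addr0 powR1 subrr. Qed.

Let K0r (y z : R) : ~~ (z != 0) -> (1 + y * z) `^ r - 1 = 0.
Proof. by rewrite mulrC; apply: K0l. Qed.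

Lemma loewner_ge_suff :
  ((size D)%:R <= r + 1 \/ exists m : nat, r = m%:R) -> psdmx M.
Proof.
move=> Hr; split=> [|v].
  by apply/matrixP => i j; rewrite mxE !ME [x j * _]mulrC [b j `^ r * _]mulrC.
rewrite mul_form_qform qform_map.
pose l := [seq (v i 0 * b i `^ r, x i) | i <- index_enum 'I_n].
suff : 0 <= qform (fun y z => (1 + y * z) `^ r - 1) l.
  rewrite qform_map; congr (0 <= _).
  by apply: eq_bigr => i _; apply: eq_bigr => j _ /=; rewrite ME; ring.
rewrite -(qform_filter (P := fun y => y != 0)) //.
apply: (@qform_powR_sub1_ge0 _ D) => //.
- move=> y z; rewrite !mem_filter => /andP[_ /distinct_valuesP[i <-]] /andP[_ /distinct_valuesP[j <-]].
  exact: xx_gt0.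
- move=> a; rewrite !mem_filter => /andP[-> /mapP[i _ ->]] /=.
  by apply/distinct_valuesP; exists i.
Qed.

Lemma loewner_ge_nec :
  psdmx M -> (size D)%:R <= r + 1 \/ exists m : nat, r = m%:R.
Proof.
move=> Mpsd; have [|rD] := lerP (size D)%:R (r + 1); [by left | right].
pose m := Num.trunc r; have /andP[mr rm] := truncn_itv r_ge0.
have [rE|rm'] := eqVneq r m%:R; first by exists m.
have mr' : m%:R < r < m.+1%:R by rewrite rm lt_neqAle eq_sym rm' mr.
(* This gives at least [m + 2] nonzero values; adding 0 makes the [m + 3] points of
   [powR_form_lt0]. *)
have mD : (m.+1 < size D)%N.
  by rewrite -(ltr_nat R) -natr1 (le_lt_trans _ rD) // lerD2r.
pose Y := sort <=%R (0 :: D).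
have Y_uniq : uniq Y.
  by rewrite sort_uniq /= mem_filter eqxx /= filter_uniq // undup_uniq.
have Ysize : size Y = (size D).+1 by rewrite size_sort.
have Y_sorted : sorted <%R Y.
  by rewrite lt_sorted_uniq_le Y_uniq sort_le_sorted.
have YP y : y \in Y -> y = 0 \/ exists i, x i = y.
  rewrite mem_sort inE => /orP[/eqP ->|]; first by left.
  by rewrite mem_filter => /andP[_ /distinct_valuesP]; right.
have YY y z : y \in Y -> z \in Y -> 0 < 1 + y * z.
  move=> /YP[->|[i <-]]; first by rewrite mul0r addr0.
  by move=> /YP[->|[j <-]]; [rewrite mulr0 addr0 | apply: xx_gt0].
have YN i : (i < m.+3)%N -> (i < size Y)%N by rewrite Ysize => im; lia.
have [c] := @powR_form_lt0 R m r (nth 0 Y) mr'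
  (fun i j ij jm => sorted_ltn_nth lt_trans 0 Y_sorted _ _
     (YN i (ltn_trans ij jm)) (YN j jm) ij)
  (fun i j im jm => YY _ _ (mem_nth 0 (YN i im)) (mem_nth 0 (YN j jm))).
rewrite ltNge => /negP[].
pose l := [seq (c (nat_of_ord i), nth 0 Y i) | i <- index_enum 'I_m.+3].
rewrite (_ : \sum_(_ < _) _ = qform (fun y z => (1 + y * z) `^ r) l); last first.
  by rewrite qform_map.
rewrite qform_add1 addr_ge0 ?sqr_ge0 //.
(* The kernel vanishes at 0, the only point of [Y] that may fail to be a value of [x]; the others
   are pulled back to indices. *)
rewrite -(qform_filter (P := fun y => y != 0)) //.
have [a|l' ->] := exists_preimage_seq (f := x) (l := [seq a <- l | a.2 != 0]).
  rewrite mem_filter => /andP[a0 /mapP[i _ aE]].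
  have /YP[y0|//] := mem_nth 0 (YN i (ltn_ord i)).
    by rewrite aE /= y0 eqxx in a0.
  by rewrite aE.
(* Dividing the weights by the powers of [b] undoes the diagonal congruence. *)
have := psdmx_qform_ge0 [seq (a.1 / b a.2 `^ r, a.2) | a <- l'] Mpsd.
rewrite !qform_map; congr (0 <= _).
apply: eq_bigr => i _; apply: eq_bigr => j _ /=; rewrite ME; field.
by rewrite !gt_eqF ?powR_gt0.
Qed.

Lemma loewner_ge_hadamard_pow :
  loewner_ge (hadamard_pow r A) (hadamard_pow r B) <->
  (size D)%:R <= r + 1 \/ exists m : nat, r = m%:R.
Proof. by split; [apply: loewner_ge_nec | apply: loewner_ge_suff]. Qed.

End Criterion.

(** * Rank one factors and the Hadamard power rank *)

(** In a rank factorization [u *m v], symmetry makes [u] a multiple [lam] of the transpose of [v],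
    and a diagonal entry shows [0 <= lam]; its square root is shared between the two factors. *)
Lemma psdmx_rank1 (R : realType) (n : nat) (M : 'M[R]_n) :
  psdmx M -> \rank M = 1%N ->
  exists c : 'I_n -> R, forall i j, M i j = c i * c j.
Proof.
move=> Mpsd rk; have [Msym _] := Mpsd.
have M0 : M != 0 by rewrite -mxrank_eq0 rk.
move: (col_base M) (row_base M) (mulmx_base M); rewrite rk => u v uv.
have ME i j : M i j = u i 0 * v 0 j by rewrite -uv mxE big_ord1.
have [p vp] : exists p, v 0 p != 0.
  apply/existsP; apply: contraNT M0 => /existsPn v0.
  by apply/eqP/matrixP => i j; rewrite ME (eqP (negPn (v0 j))) mulr0 mxE.
pose lam := u p 0 / v 0 p.
have uE i : u i 0 = lam * v 0 i.
  have := congr1 (fun N : 'M[R]_n => N i p) Msym; rewrite mxE !ME => E.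
  by apply: (mulIf vp); rewrite -E /lam; field.
have lam0 : 0 <= lam.
  have := psdmx_qform_ge0 [:: (1, p)] Mpsd.
  rewrite /qform !big_seq1 /= ME uE mulr1 mul1r -mulrA -expr2.
  by rewrite pmulr_lge0 // exprn_even_gt0.
exists (fun i => Num.sqrt lam * v 0 i) => i j.
by rewrite ME uE -{1}(sqr_sqrtr lam0); ring.
Qed.

Section ColumnClasses.
Variables (R : realType) (n : nat) (b x : 'I_n -> R) (A : 'M[R]_n).
Hypotheses (b_gt0 : forall i, 0 < b i).
Hypothesis AE : forall i j, A i j = b i * b j * (1 + x i * x j).

Lemma rank2_nonconstant : \rank A = 2%N -> exists i j, x i != x j.
Proof.
move=> rk; apply: contrapT => x_const.
have : (\rank A <= 1)%N; last by rewrite rk.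
have -> : A = (\col_i b i) *m (\row_j (b j * (1 + x j * x j))).
  apply/matrixP => i j; rewrite mxE big_ord1 !mxE AE mulrA.
  have [->//|xij] := eqVneq (x i) (x j).
  by case: x_const; exists i, j.
exact: mulmx_max_rank.
Qed.

Hypothesis x_nonconst : exists i j, x i != x j.

(** Proportionality equates two affine functions of [x l]; as [x] takes two values, their slopes and
    constant terms agree. *)
Lemma col_multiple i j : (exists c, col i A = c *: col j A) <-> x i = x j.
Proof.
split=> [[c cE]|xij].
  have E l : b i * (1 + x l * x i) = c * b j * (1 + x l * x j).
    have := congr1 (fun N : 'cV[R]_n => N l 0) cE; rewrite !mxE !AE => E.
    by apply: (mulfI (lt0r_neq0 (b_gt0 l))); rewrite mulrA E; ring.
  have [p [q pq]] := x_nonconst.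
  have {}pq : x p - x q != 0 by rewrite subr_eq0.
  have bx : b i * x i = c * b j * x j.
    by apply: (mulfI pq); have := E p; have := E q; lra.
  have bE : b i = c * b j.
    have := E p; rewrite !mulrDr !mulr1 ![_ * (x p * _)]mulrCA bx.
    exact: addIr.
  by apply: (mulfI (lt0r_neq0 (b_gt0 i))); rewrite bx bE.
exists (b i / b j); apply/matrixP => l l'; rewrite !mxE !AE xij; field.
exact: lt0r_neq0.
Qed.

(** By [col_multiple], the admissible sets are those on which [x] is injective; one index per value
    attains the maximum. *)
Lemma hadamard_power_rankE :
  hadamard_power_rank A = size (distinct_values x).
Proof.
apply/eqP; rewrite eqn_leq; apply/andP; split.
  apply/bigmax_leqP => S /asboolP SA.
  have xS : {in S &, injective x}.
    move=> i j iS jS xij; apply: contrapT => /eqP ij.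
    by apply: (SA i j iS jS ij); apply/col_multiple.
  rewrite cardE -(size_map x); apply: uniq_leq_size => [|_ /mapP[i _ ->]].
    by rewrite map_inj_in_uniq ?enum_uniq // => i j;
      rewrite !mem_enum; apply: xS.
  by apply/distinct_valuesP; exists i.
have [s xs] : exists s : seq 'I_n, distinct_values x = [seq x i | i <- s].
  have : {subset distinct_values x <= distinct_values x} by [].
  elim: {1 3}(distinct_values x) => [_|y l IH yl]; first by exists [::].
  have [s ->] := IH (fun z zl => yl z (mem_behead (s := y :: l) zl)).
  have /distinct_valuesP[i <-] := yl y (mem_head _ _).
  by exists (i :: s).
have := undup_uniq [seq x i | i <- enum 'I_n].
rewrite -/(distinct_values x) xs size_map => xs_uniq.
have s_uniq := map_uniq xs_uniq.
rewrite -(card_uniqP s_uniq) -cardsE.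
apply: leq_bigmax_cond; apply/asboolP => i j; rewrite !inE => si sj ij.
move=> /col_multiple xij; case/eqP: ij.
apply: (@index_inj _ i s) => //; apply/eqP.
have := nth_uniq (x i) (i := index i s) (j := index j s) _ _ xs_uniq.
rewrite !size_map !index_mem => /(_ si sj) <-.
by rewrite !(nth_map i) ?index_mem // !nth_index ?xij.
Qed.

Lemma size_distinct_values_gt1 : (1 < size (distinct_values x))%N.
Proof.
have [i [j xij]] := x_nonconst.
apply: (@uniq_leq_size _ [:: x i; x j]); first by rewrite /= inE xij.
by move=> y; rewrite !inE => /orP[] /eqP ->; apply/distinct_valuesP;
  [exists i | exists j].
Qed.

End ColumnClasses.

(** Only the boundary [r = p - 1] moves, from the inequality to the list of naturals; larger
    naturals satisfy the strict inequality. *)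
Lemma exponent_range (R : realType) (p : nat) (r q : R) :
  (0 < p)%N -> q = p%:R - 1 ->
  (p%:R <= r + 1 \/ exists m : nat, r = m%:R) <->
  (q < r \/ exists m : nat, (m <= p - 1)%N /\ r = m%:R).
Proof.
case: p => // p _ ->; rewrite subSS subn0 -natr1 addrK lerD2r.
split=> [Hr|[rp|[m [_ rm]]]]; last 2 first.
- by left; apply: ltW.
- by right; exists m.
have [rp|rp] := ltrP p%:R r; [by left | right].
case: Hr => [pr|[m rm]].
  by exists p; split=> //; apply/eqP; rewrite eq_le rp pr.
by exists m; split=> //; rewrite -(ler_nat R) -rm.
Qed.

Theorem theorem10 (R : realType) (n : nat) (A B : 'M[R]_n) (k : nat) (r : R)
  (A_psd : psdmx A) (A_rank : \rank A = 2%N)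
  (B_psd : psdmx B) (B_rank : \rank B = 1%N)
  (A_pos : forall i j : 'I_n, 0 < A i j)
  (B_pos : forall i j : 'I_n, 0 < B i j)
  (AB_ge : loewner_ge A B) (AB_rank : \rank (A - B) = 1%N)
  (k_def : k = hadamard_power_rank A) (r_ge0 : 0 <= r) :
  ((forall i : 'I_n, (A - B) i i != 0) ->
     (loewner_ge (hadamard_pow r A) (hadamard_pow r B) <->
        (k%:R - 1 < r \/ exists m : nat, (m <= k - 1)%N /\ r = m%:R)))
  /\
  ((exists i : 'I_n, (A - B) i i = 0) ->
     (loewner_ge (hadamard_pow r A) (hadamard_pow r B) <->
        (k%:R - 2 < r \/ exists m : nat, (m <= k - 2)%N /\ r = m%:R))).
Proof.
have [b0 b0E] := psdmx_rank1 B_psd B_rank.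
have [c cE] := psdmx_rank1 AB_ge AB_rank.
(* All products [b0 i * b0 j] are positive, so absolute values leave [B] unchanged. *)
pose b i := `|b0 i|; pose x i := c i / b i.
have b_gt0 i : 0 < b i.
  rewrite normr_gt0; apply/eqP => bi0.
  by have := B_pos i i; rewrite b0E bi0 mul0r ltxx.
have BE i j : B i j = b i * b j.
  by rewrite /b -normrM -b0E gtr0_norm.
have bN0 i := lt0r_neq0 (b_gt0 i).
have AE i j : A i j = b i * b j * (1 + x i * x j).
  have := cE i j; rewrite !mxE => /eqP; rewrite subr_eq => /eqP ->.
  by rewrite BE /x; field; rewrite !bN0.
have xx i j : 0 < 1 + x i * x j.
  by have := A_pos i j; rewrite AE pmulr_rgt0 // mulr_gt0.
have x_nonconst := rank2_nonconstant AE A_rank.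
have kE : k = size (distinct_values x).
  by rewrite k_def (hadamard_power_rankE b_gt0 AE x_nonconst).
(* Hence the natural subtractions [k - 1] and [k - 2] do not truncate. *)
have k_gt1 : (1 < k)%N by rewrite kE; apply: size_distinct_values_gt1.
have x_eq0 i : (x i == 0) = ((A - B) i i == 0).
  by rewrite cE [RHS]mulf_eq0 orbb mulf_eq0 invr_eq0 (negPf (bN0 i)) orbF.
have X_uniq : uniq (distinct_values x) by apply: undup_uniq.
have crit := loewner_ge_hadamard_pow b_gt0 xx AE BE r_ge0.
split=> [diag|[i diag]]; apply: (iff_trans crit).
  rewrite (_ : [seq y <- _ | y != 0] = distinct_values x); last first.
    by apply/all_filterP/allP => _ /distinct_valuesP[i <-]; rewrite x_eq0 diag.
  by rewrite -kE; apply: exponent_range => //; apply: ltnW.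
(* Here 0 is a value of [x], listed exactly once, so the count of nonzero values is [k - 1]. *)
have -> : size [seq y <- distinct_values x | y != 0] = k.-1.
  rewrite -(rem_filter 0 X_uniq) size_rem ?kE //.
  by apply/distinct_valuesP; exists i; apply/eqP; rewrite x_eq0 diag.
rewrite -subn1 (_ : k - 2 = k - 1 - 1)%N; last by lia.
apply: exponent_range; first by rewrite subn_gt0.
by rewrite natrB ?(ltnW k_gt1) //; lra.
Qed.
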